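(* For every positive integer $n$, the following two identities hold as identities of rational functions in $x$ (that is, for all complex $x$ at which the denominators do not vanish): $$\frac{L_{n}(2x)}{4x(x^{2}+1)F_{n}(2x)}=\frac{U_{n-1}(2x^{2}+1)}{T_{n}(2x^{2}+1)+(-1)^{n-1}}$$ and $$\frac{F_{n}(2x)}{xL_{n}(2x)}=\frac{U_{n-1}(2x^{2}+1)}{T_{n}(2x^{2}+1)+(-1)^{n}}.$$
   Context: The Fibonacci polynomials are defined by $F_0(x)=0$, $F_1(x)=1$, $F_n(x)=xF_{n-1}(x)+F_{n-2}(x)$ for $n\ge 2$. The Lucas polynomials are defined by $L_0(x)=2$, $L_1(x)=x$, $L_n(x)=xL_{n-1}(x)+L_{n-2}(x)$ for $n\ge 2$. $T_n$ and $U_n$ denote the Chebyshev polynomials of the first and second kind, i.e. the unique polynomials with $T_n(\cos\theta)=\cos(n\theta)$ and $U_n(\cos\theta)\sin\theta=\sin((n+1)\theta)$. *)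

(* Defs.v *)
From HB Require Import structures.
From mathcomp Require Import all_boot all_order all_algebra.
From mathcomp Require Import fraction complex.
From mathcomp Require Import reals trigo.
From mathcomp Require Import ring lra.
Set Implicit Arguments.
Unset Strict Implicit.
Unset Printing Implicit Defensive.
Import Order.TTheory GRing.Theory Num.Theory.
Local Open Scope ring_scope.
Local Open Scope complex_scope.

Notation "p %:F" := (tofrac p) : ring_scope.

Fixpoint fibp (A : nzRingType) (n : nat) : {poly A} :=
  match n with
  | 0 => 0
  | 1 => 1
  | (m.+1 as k).+1 => 'X * fibp A k + fibp A m
  end.

Fixpoint lucp (A : nzRingType) (n : nat) : {poly A} :=
  match n with
  | 0 => 2%:P
  | 1 => 'X
  | (m.+1 as k).+1 => 'X * lucp A k + lucp A m
  end.

Definition is_chebT (R : realType) (n : nat) (p : {poly R[i]}) : Prop :=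
  forall t : R, p.[(cos t)%:C] = (cos (n%:R * t))%:C.

Definition is_chebU (R : realType) (n : nat) (p : {poly R[i]}) : Prop :=
  forall t : R, p.[(cos t)%:C] * (sin t)%:C = (sin (n.+1%:R * t))%:C.

(* The two predicates above each hold of exactly one polynomial; this is
   [is_chebT_unique] and [is_chebU_unique] below. *)

Lemma chebT_exists (R : realType) n : exists p : {poly R[i]}, is_chebT n p.
Proof.
suff [p [q [hp hq]]] : exists p q : {poly R[i]}, is_chebT n p /\ is_chebT n.+1 q.
  by exists p.
elim: n => [|n [p [q [hp hq]]]].
  exists 1, 'X; split=> t; first by rewrite mul0r cos0 hornerC.
  by rewrite mul1r hornerX.
exists q, (2%:P * 'X * q - p); split=> // t.
rewrite hornerD hornerN hp !hornerM hornerX hornerC hq.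
have -> : n.+2%:R * t = n.+1%:R * t + t by rewrite -[n.+2]addn1 natrD; ring.
have -> : n%:R * t = n.+1%:R * t - t by rewrite -[n.+1]addn1 natrD; ring.
rewrite [cos (_ + t)]cosD [cos (_ - t)]cosB !rmorphB /= !rmorphD /= !rmorphM /=; ring.
Qed.

Lemma chebU_exists (R : realType) n : exists p : {poly R[i]}, is_chebU n p.
Proof.
suff [p [q [hp hq]]] : exists p q : {poly R[i]}, is_chebU n p /\ is_chebU n.+1 q.
  by exists p.
elim: n => [|n [p [q [hp hq]]]].
  exists 1, (2%:P * 'X); split=> t; first by rewrite mul1r hornerC mul1r.
  have -> : 2%:R * t = t + t by ring.
  rewrite sinD !hornerE !rmorphD /= !rmorphM /=; ring.
exists q, (2%:P * 'X * q - p); split=> // t.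
rewrite hornerD hornerN mulrBl hp !hornerM hornerX hornerC -(mulrA _ q.[_]) hq.
have -> : n.+3%:R * t = n.+2%:R * t + t by rewrite -[n.+3]addn1 natrD; ring.
have -> : n.+1%:R * t = n.+2%:R * t - t by rewrite -[n.+2]addn1 natrD; ring.
rewrite [sin (_ + t)]sinD [sin (_ - t)]sinB !rmorphB /= !rmorphD /= !rmorphM /=; ring.
Qed.

Lemma poly_eq_cos (R : realType) (p q : {poly R[i]}) :
  (forall t : R, 0 < t < pi -> p.[(cos t)%:C] = q.[(cos t)%:C]) -> p = q.
Proof.
move=> h; apply/eqP; rewrite -subr_eq0; apply/negPn/negP => nz.
pose s := [seq (cos (pi / k.+2%:R : R))%:C | k <- iota 0 (size (p - q))].
have I k : 0 < (pi : R) / k.+2%:R < pi.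
  rewrite divr_gt0 ?pi_gt0 ?ltr0n //= ltr_pdivrMr ?ltr0n //.
  by rewrite -[ltLHS]mulr1 ltr_pM2l ?pi_gt0 // ltr1n.
have := max_poly_roots nz (rs := s); rewrite size_map size_iota ltnn.
move=> H; suff: false by []; apply: H.
  apply/allP => x /mapP[k _ ->].
  by rewrite /root hornerD hornerN h ?subrr // I.
rewrite map_inj_uniq ?iota_uniq // => k l /(@complexI R) /cos_inj.
rewrite !in_itv /=.
have /andP[/ltW -> /ltW ->] := I k; have /andP[/ltW -> /ltW ->] := I l.
move=> /(_ isT isT) /(mulfI (lt0r_neq0 (pi_gt0 R))) /invr_inj /eqP.
by rewrite eqr_nat => /eqP [].
Qed.

Lemma is_chebT_unique (R : realType) n : exists! p : {poly R[i]}, is_chebT n p.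
Proof.
have [p hp] := chebT_exists R n; exists p; split=> // q hq.
by apply: poly_eq_cos => t _; rewrite hp hq.
Qed.

Lemma is_chebU_unique (R : realType) n : exists! p : {poly R[i]}, is_chebU n p.
Proof.
have [p hp] := chebU_exists R n; exists p; split=> // q hq.
apply: poly_eq_cos => t /sin_gt0_pi st.
have nz : (sin t)%:C != 0 by rewrite fmorph_eq0 lt0r_neq0.
by apply: (mulIf nz); rewrite hp hq.
Qed.

(* Main.v *)
(* With x = sinh t, F_n(2x) and L_n(2x) have the Binet forms
   (a^n - b^n) / (a - b) and a^n + b^n for a = e^t and b = - e^-t, while
   2x^2 + 1 = cosh 2t.  This suggests the three identities
     L_n(2x)^2 = 2 (T_n(2x^2+1) + (-1)^n),
     2 (x^2+1) F_n(2x)^2 = T_n(2x^2+1) - (-1)^n,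
     F_n(2x) L_n(2x) = 2x U_{n-1}(2x^2+1),
   which are closed under the first-order recurrences of the pairs (F, L) and
   (T, U) and from which both quotients follow. *)
Require Import Defs.
From mathcomp Require Import all_boot all_order all_algebra.
From mathcomp Require Import fraction complex reals trigo.
From mathcomp Require Import ring.
Import GRing.Theory.
Local Open Scope ring_scope.

Lemma fibpSS (A : nzRingType) n : fibp A n.+2 = 'X * fibp A n.+1 + fibp A n.
Proof. by []. Qed.

Lemma lucpSS (A : nzRingType) n : lucp A n.+2 = 'X * lucp A n.+1 + lucp A n.
Proof. by []. Qed.

(** In Binet terms [L_n + F_n * sqrt(x^2 + 4)] is [2 * a^n] with [a = (x + sqrt(x^2 + 4)) / 2];
    multiplying by [a] and separating the two components gives this system. The factors 2 avoid
    division. Since the defining recurrences have order two, the induction carries two consecutive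
    indices. *)
Lemma fib_luc_rec (A : comNzRingType) n :
  2 * fibp A n.+1 = 'X * fibp A n + lucp A n /\
  2 * lucp A n.+1 = 'X * lucp A n + ('X^2 + 4) * fibp A n.
Proof.
suff: (2 * fibp A n.+1 = 'X * fibp A n + lucp A n /\
       2 * lucp A n.+1 = 'X * lucp A n + ('X^2 + 4) * fibp A n) /\
      (2 * fibp A n.+2 = 'X * fibp A n.+1 + lucp A n.+1 /\
       2 * lucp A n.+2 = 'X * lucp A n.+1 + ('X^2 + 4) * fibp A n.+1) by case.
elim: n => [|n [[f0 l0] [f1 l1]]].
  by split; split; rewrite /= ?polyC_natr; ring.
split=> //; move: (fibpSS A n) (fibpSS A n.+1) (lucpSS A n) (lucpSS A n.+1) f0 l0 f1 l1.
move: (fibp A n) (lucp A n) (fibp A n.+1) (lucp A n.+1) => F0 L0 F1 L1.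
move: (fibp A n.+2) (lucp A n.+2) (fibp A n.+3) (lucp A n.+3) => F2 L2 F3 L3.
move=> eF2 -> eL2 -> f0 l0 f1 l1; rewrite !mulrDr !(mulrCA 2).
by rewrite f1 l1 f0 l0 eF2 eL2; split; ring.
Qed.

(** The recurrences preserve positivity at 1, and one positive value shows that a polynomial is
    nonzero. The Fibonacci index starts at 1 because [fibp K 0] is zero. *)
Lemma fib_luc_gt0 (K : numDomainType) n :
  0 < (fibp K n.+1).[1] /\ 0 < (lucp K n).[1].
Proof.
suff: (0 < (fibp K n.+1).[1] /\ 0 < (lucp K n).[1]) /\
      (0 < (fibp K n.+2).[1] /\ 0 < (lucp K n.+1).[1]) by case.
elim: n => [|n [[f0 l0] [f1 l1]]].
  by rewrite /= !hornerE; split; split; rewrite ?Num.Theory.ltr0n ?Num.Theory.ltr01.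
split=> //; rewrite [fibp K n.+3]fibpSS [lucp K n.+2]lucpSS.
by rewrite !hornerD !hornerM !hornerX !mul1r !Num.Theory.addr_gt0.
Qed.

Section Chebyshev.
Variables (R : realType) (T U : nat -> {poly R[i]}).
Hypothesis hT : forall k, is_chebT k (T k).
Hypothesis hU : forall k, is_chebU k (U k).

Lemma chebT1 : T 1 = 'X.
Proof. by apply: poly_eq_cos => t _; rewrite hT mul1r hornerX. Qed.

Lemma chebU0 : U 0 = 1.
Proof.
have [p [_ up]] := is_chebU_unique R 0.
by rewrite -(up _ (hU 0)); apply: up => t; rewrite hornerC !mul1r.
Qed.

(** Addition formula for [cos((n+1)t + t)]: the product of sines is [sin^2 t * U_n(cos t)], and
    [- sin^2 t = cos^2 t - 1]. *)
Lemma chebT_rec n : T n.+2 = 'X * T n.+1 + ('X^2 - 1) * U n.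
Proof.
apply: poly_eq_cos => t _.
have e : (cos t)%:C%C ^+ 2 - 1 = - (sin t)%:C%C ^+ 2 :> R[i].
  rewrite -!rmorphXn -(rmorph1 (real_complex R)) -rmorphB -rmorphN /= cos2sin2.
  by congr _%:C%C; ring.
have -> : (T n.+2).[(cos t)%:C%C] =
  (cos t)%:C%C * (cos (n.+1%:R * t))%:C%C - (sin t)%:C%C * (sin (n.+1%:R * t))%:C%C.
  rewrite hT -(addn1 n.+1) natrD mulrDl mul1r cosD rmorphB !rmorphM /=; ring.
by rewrite !hornerE hT e -hU; ring.
Qed.

(** Addition formula for [sin((n+1)t + t)], divided by [sin t], which is positive for
    [0 < t < pi]. *)
Lemma chebU_rec n : U n.+1 = 'X * U n + T n.+1.
Proof.
apply: poly_eq_cos => t /sin_gt0_pi st.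
have nz : (sin t)%:C%C != 0 by rewrite fmorph_eq0 Num.Theory.lt0r_neq0.
apply: (mulIf nz); rewrite hU hornerD hornerM hornerX [RHS]mulrDl -mulrA hU hT.
by rewrite -(addn1 n.+1) natrD mulrDl mul1r sinD rmorphD !rmorphM /=; ring.
Qed.

Let y : {poly R[i]} := 2 *: 'X.
Let z : {poly R[i]} := 2 *: 'X^2 + 1.

(** The three identities need a joint induction: by the linear system for [(f, l)], each next
    quadratic expression is a combination of [l^2], [f^2] and [f * l] at the current index. *)
Lemma fib_luc_cheb n :
  let f := fibp R[i] n.+1 \Po y in
  let l := lucp R[i] n.+1 \Po y in
  let t := T n.+1 \Po z in
  let u := U n \Po z in
  [/\ l ^+ 2 = 2 * (t + (-1) ^+ n.+1),
      2 * ('X^2 + 1) * f ^+ 2 = t - (-1) ^+ n.+1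
    & f * l = 2 * 'X * u].
Proof.
have yE : y = 2 * 'X by rewrite /y -mul_polyC polyC_natr.
have zE : z = 2 * 'X^2 + 1 by rewrite /z -mul_polyC polyC_natr.
have cN k : (k%:R : {poly R[i]}) \Po y = k%:R by rewrite -polyC_natr comp_polyC.
elim: n => [|n].
  rewrite /= chebT1 chebU0 !comp_polyX -!polyC1 !comp_polyC polyC1 yE zE.
  by split; ring.
cbv zeta; set f := fibp _ n.+1 \Po y; set l := lucp _ n.+1 \Po y.
set t := T n.+1 \Po z; set u := U n \Po z; move=> [hl hf hfl].
set f' := fibp _ n.+2 \Po y; set l' := lucp _ n.+2 \Po y.
have [ef el] : 2 * f' = y * f + l /\ 2 * l' = y * l + (y ^+ 2 + 4) * f.
  rewrite /f' /l' /f /l; have := fib_luc_rec R[i] n.+1.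
  move: (fibp _ n.+1) (lucp _ n.+1) (fibp _ n.+2) (lucp _ n.+2) => F0 L0 F1 L1.
  case=> /(congr1 (comp_poly y)) + /(congr1 (comp_poly y)).
  by rewrite !expr2 !(cN, comp_polyX, comp_polyM, comp_polyD) => ? ?.
have -> : T n.+2 \Po z = z * t + (z ^+ 2 - 1) * u.
  by rewrite chebT_rec comp_polyD !comp_polyM comp_polyB comp_Xn_poly comp_polyX
    -polyC1 comp_polyC.
have -> : U n.+1 \Po z = z * u + t by rewrite chebU_rec comp_polyD comp_polyM comp_polyX.
rewrite [(-1) ^+ n.+2]exprS; move: hl hf; set e := (-1) ^+ n.+1 => hl hf.
(* The system gives [2 * f'] and [2 * l'], so each quadratic identity is proved after multiplication
   by 4. *)
have n4 : 4 != 0 :> {poly R[i]} by rewrite -polyC_natr polyC_eq0 Num.Theory.pnatr_eq0.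
split; apply: (mulfI n4).
- have -> : 4 * l' ^+ 2 = (2 * l') ^+ 2 by ring.
  (* The terms are grouped so that the left-hand sides of the three induction hypotheses appear
     verbatim. *)
  have -> : (2 * l') ^+ 2 = 4 * 'X^2 * l ^+ 2 + 16 * 'X * ('X^2 + 1) * (f * l)
     + 8 * ('X^2 + 1) * (2 * ('X^2 + 1) * f ^+ 2) by rewrite el yE; ring.
  by rewrite hl hf hfl zE; ring.
- have -> : 4 * (2 * ('X^2 + 1) * f' ^+ 2) = 2 * ('X^2 + 1) * (2 * f') ^+ 2 by ring.
  rewrite ef yE.
  have -> : 2 * ('X^2 + 1) * (2 * 'X * f + l) ^+ 2 =
    4 * 'X^2 * (2 * ('X^2 + 1) * f ^+ 2) + 8 * 'X * ('X^2 + 1) * (f * l)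
    + 2 * ('X^2 + 1) * l ^+ 2 by ring.
  by rewrite hl hf hfl zE; ring.
have -> : 4 * (f' * l') = (2 * f') * (2 * l') by ring.
have -> : (2 * f') * (2 * l') = 2 * 'X * l ^+ 2 + (8 * 'X^2 + 4) * (f * l)
  + 4 * 'X * (2 * ('X^2 + 1) * f ^+ 2) by rewrite ef el yE; ring.
by rewrite hl hf hfl zE; ring.
Qed.

End Chebyshev.

Theorem theorem1p1 (R : realType) (T U : nat -> {poly R[i]})
    (hT : forall k : nat, is_chebT k (T k))
    (hU : forall k : nat, is_chebU k (U k))
    (n : nat) (hn : (0 < n)%N) :
  let F := fibp R[i] in
  let L := lucp R[i] in
  let y : {poly R[i]} := 2 *: 'X in
  let z : {poly R[i]} := 2 *: 'X^2 + 1 in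
  [/\ 4 *: 'X * ('X^2 + 1) * (F n \Po y) != 0,
      (T n \Po z) + (-1) ^+ n.-1 != 0,
      (L n \Po y)%:F / (4 *: 'X * ('X^2 + 1) * (F n \Po y))%:F
        = (U n.-1 \Po z)%:F / ((T n \Po z) + (-1) ^+ n.-1)%:F
    & forall x : R[i],
        4 * x * (x ^+ 2 + 1) * (F n).[2 * x] != 0 ->
        (T n).[2 * x ^+ 2 + 1] + (-1) ^+ n.-1 != 0 ->
        (L n).[2 * x] / (4 * x * (x ^+ 2 + 1) * (F n).[2 * x])
          = (U n.-1).[2 * x ^+ 2 + 1]
            / ((T n).[2 * x ^+ 2 + 1] + (-1) ^+ n.-1)]
  /\
  [/\ 'X * (L n \Po y) != 0,
      (T n \Po z) + (-1) ^+ n != 0,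
      (F n \Po y)%:F / ('X * (L n \Po y))%:F
        = (U n.-1 \Po z)%:F / ((T n \Po z) + (-1) ^+ n)%:F
    & forall x : R[i],
        x * (L n).[2 * x] != 0 ->
        (T n).[2 * x ^+ 2 + 1] + (-1) ^+ n != 0 ->
        (F n).[2 * x] / (x * (L n).[2 * x])
          = (U n.-1).[2 * x ^+ 2 + 1]
            / ((T n).[2 * x ^+ 2 + 1] + (-1) ^+ n)].
Proof.
case: n hn => // n _ F L y z.
have [] := fib_luc_cheb R T U hT hU n; rewrite -/y -/z -/F -/L.
have zx x : z.[x] = 2 * x ^+ 2 + 1 by rewrite !hornerE.
have yx x : y.[x] = 2 * x by rewrite !hornerE.
set f := F n.+1 \Po y; set l := L n.+1 \Po y; set t := T n.+1 \Po z.
set u := U n \Po z; rewrite [n.+1.-1]/= => hl hf hfl.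
have n2 : 2 != 0 :> {poly R[i]} by rewrite -polyC_natr polyC_eq0 Num.Theory.pnatr_eq0.
(* At [x = 1/2] the argument [2x] is 1, where positivity is known. *)
have y1 : 2 * 2^-1 = 1 :> R[i] by rewrite divff // Num.Theory.pnatr_eq0.
have [f1 _] := fib_luc_gt0 R[i] n; have [_ l1] := fib_luc_gt0 R[i] n.+1.
have f0 : f != 0.
  apply/eqP => /(congr1 (horner^~ 2^-1)); rewrite horner_comp yx y1 horner0.
  by apply/eqP; rewrite Num.Theory.lt0r_neq0.
have l0 : l != 0.
  apply/eqP => /(congr1 (horner^~ 2^-1)); rewrite horner_comp yx y1 horner0.
  by apply/eqP; rewrite Num.Theory.lt0r_neq0.
have X0 : 'X != 0 :> {poly R[i]} by rewrite polyX_eq0.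
have q0 : 'X^2 + 1 != 0 :> {poly R[i]} by rewrite -polyC1 monic_neq0 // monicXnaddC.
have s4 : 4 *: 'X = 4 * 'X :> {poly R[i]} by rewrite -mul_polyC polyC_natr.
have n4 : 4 != 0 :> {poly R[i]} by rewrite -polyC_natr polyC_eq0 Num.Theory.pnatr_eq0.
have sgn : t + (-1) ^+ n = t - (-1) ^+ n.+1 by rewrite exprS; ring.
(* The first quotient cross-multiplied: [2 * ('X^2 + 1) * f^2] replaces the Chebyshev denominator,
   then [f * l = 2 * 'X * u]. *)
have id1 : l * (t + (-1) ^+ n) = u * (4 *: 'X * ('X^2 + 1) * f).
  rewrite sgn -hf s4.
  have -> : l * (2 * ('X^2 + 1) * f ^+ 2) = 2 * ('X^2 + 1) * f * (f * l) by ring.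
  by rewrite hfl; ring.
(* The second quotient cross-multiplied, doubled so that [l^2] can replace the Chebyshev
   denominator. *)
have id2 : f * (t + (-1) ^+ n.+1) = u * ('X * l).
  apply: (mulfI n2); rewrite mulrCA -hl.
  have -> : f * l ^+ 2 = f * l * l by ring.
  by rewrite hfl; ring.
have d1 : 4 *: 'X * ('X^2 + 1) * f != 0 by rewrite s4 !mulf_neq0.
(* The Chebyshev denominators inherit nonvanishing from [f^2] here and from [l^2] in [d4]. *)
have d2 : t + (-1) ^+ n != 0 by rewrite sgn -hf !mulf_neq0 // expf_neq0.
have d3 : 'X * l != 0 by rewrite mulf_neq0.
have d4 : t + (-1) ^+ n.+1 != 0.
  by have := expf_neq0 2 l0; rewrite hl mulf_eq0 negb_or => /andP[].
have sgx k x : ((-1) ^+ k : {poly R[i]}).[x] = (-1) ^+ k by rewrite !hornerE.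
have dx x : (4 *: 'X * ('X^2 + 1) : {poly R[i]}).[x] = 4 * x * (x ^+ 2 + 1).
  by rewrite !hornerE.
split; split=> //.
- by apply/eqP; rewrite eqr_div ?tofrac_eq0 // -!tofracM id1.
(* The pointwise claim is the cross-multiplied polynomial identity evaluated at [x]. *)
- move=> x a b; apply/eqP; rewrite eqr_div //; apply/eqP.
  have := congr1 (horner^~ x) id1.
  by rewrite !(dx, sgx, hornerM, hornerD) !horner_comp yx zx.
- by apply/eqP; rewrite eqr_div ?tofrac_eq0 // -!tofracM id2.
move=> x a b; apply/eqP; rewrite eqr_div //; apply/eqP.
have := congr1 (horner^~ x) id2.
by rewrite !(sgx, hornerM, hornerD, hornerX) !horner_comp yx zx.
Qed.
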